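(* Let $m\ge 1$, let $\Omega$ be an open subset of $\mathbb{R}^m$, let $K\subset\Omega$ be a set of Lebesgue measure $0$, and let $G:\Omega\to\mathbb{R}^m$ be a Lipschitz function which is strongly differentiable at every point of $\Omega\setminus K$. Then the image under $G$ of the set $$\{x\in\Omega\setminus K\,:\,J_G(x)\text{ is singular}\}$$ has Lebesgue measure $0$.
   Context: Strong differentiability: let $U\subset\mathbb{R}^m$, let $u$ be an interior point of $U$. A function $F:U\to\mathbb{R}^n$ is strongly differentiable at $u$ if there is a linear map $A:\mathbb{R}^m\to\mathbb{R}^n$ such that $\frac{1}{\|x-y\|}\,[F(x)-F(y)-A(x-y)]\to 0$ as $(x,y)\to(u,u)$, $x\ne y$. In this case $F$ is differentiable at $u$ with derivative $A$. $J_G(x)$ denotes the Jacobi matrix of $G$ at $x$. *)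

(* Defs.v *)
From mathcomp Require Import all_boot all_order all_algebra.
From mathcomp Require Import all_classical all_reals all_analysis.
Set Implicit Arguments.
Unset Strict Implicit.
Unset Printing Implicit Defensive.
Import Order.TTheory GRing.Theory Num.Theory.
Import numFieldNormedType.Exports.
Local Open Scope classical_set_scope.
Local Open Scope ring_scope.

Definition box (R : realType) (m : nat) (a b : 'rV[R]_m) : set 'rV[R]_m :=
  [set x | forall i, a 0 i <= x 0 i <= b 0 i].

Definition box_volume (R : realType) (m : nat) (a b : 'rV[R]_m) : R :=
  \prod_(i < m) (b 0 i - a 0 i).

(* The k-th box of a cover has corners (c k).1 and (c k).2; degenerate boxes
   are allowed, so finite covers are included when 0 < m. *)
Definition box_cover (R : realType) (m : nat) (A : set 'rV[R]_m) :
    set (nat -> 'rV[R]_m * 'rV[R]_m) :=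
  [set c : nat -> 'rV[R]_m * 'rV[R]_m |
    (forall k i, (c k).1 0 i <= (c k).2 0 i) /\
    A `<=` \bigcup_k box (c k).1 (c k).2].

Definition lebesgue_outer (R : realType) (m : nat) (A : set 'rV[R]_m) : \bar R :=
  ereal_inf [set (\sum_(0 <= k <oo) (box_volume (c k).1 (c k).2)%:E)%E
            | c in box_cover A].

(* The Lebesgue measure on R^m is the restriction of the outer measure to the
   Caratheodory-measurable sets. *)
Definition has_lebesgue_measure0 (R : realType) (m : nat) (A : set 'rV[R]_m) :
    Prop :=
  (@lebesgue_outer R m).-caratheodory A /\ lebesgue_outer A = 0%E.

(* F stands for a map U -> R^n: only its values on U are used. *)
Definition strongly_differentiable (R : realType) (m n : nat)
    (U : set 'rV[R]_m) (F : 'rV[R]_m -> 'rV[R]_n) (u : 'rV[R]_m) : Prop :=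
  U^° u /\
  exists A : {linear 'rV[R]_m -> 'rV[R]_n},
    (fun p : 'rV[R]_m * 'rV[R]_m =>
       `|p.1 - p.2|^-1 *: (F p.1 - F p.2 - A (p.1 - p.2)))
    @ within [set p | [/\ U p.1, U p.2 & p.1 != p.2]] (nbhs (u, u))
    --> (0 : 'rV[R]_n).

(* Main.v *)
Require Import Defs.
From HB Require Import structures.
From mathcomp Require Import all_boot all_order all_algebra ring lra.
From mathcomp Require Import all_classical all_reals all_analysis.
Import Order.TTheory GRing.Theory Num.Theory.
Import numFieldNormedType.Exports.
Local Open Scope classical_set_scope.
Local Open Scope ring_scope.

(* Let S be the set of the theorem. If x is in S, the range of the differential
   at x lies in a hyperplane, so G maps every small cube of side t around x into
   a slab whose outer measure is at most C e t^m, with e as small as we please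
   and C depending only on m and on the Lipschitz constant. Bisect a fixed cube
   repeatedly, stopping at the subcubes Q for which the image of Q /\ S has outer
   measure at most C e |Q|. These maximal subcubes have total volume at most that
   of the cube and they cover S, so the image of S within the cube is null. *)

(** * Lebesgue outer measure as an outer measure *)

Section LebesgueOuter.
Context {R : realType}.
Local Open Scope ereal_scope.

Lemma box_volume_ge0 m (a b : 'rV[R]_m) :
  (forall i, a 0%R i <= b 0%R i)%R -> (0 <= box_volume a b)%R.
Proof. by move=> ab; apply: prodr_ge0 => i _; rewrite subr_ge0. Qed.

Lemma box_volume_degenerate p (a : 'rV[R]_p.+1) : box_volume a a = 0%R.
Proof. by rewrite /box_volume big_ord_recl subrr mul0r. Qed.

Lemma lebesgue_outer_ge0 m (A : set 'rV[R]_m) : 0 <= lebesgue_outer A.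
Proof.
apply: le_ereal_inf_tmp => _ [c [cle _] <-]; apply: nneseries_ge0 => k _ _.
by rewrite lee_fin box_volume_ge0.
Qed.

Lemma le_lebesgue_outer m :
  {homo @lebesgue_outer R m : A B / A `<=` B >-> A <= B}.
Proof.
move=> A B AB; apply: ereal_inf_le_tmp => _ [c [cle Bc] <-].
by exists c => //; split => //; exact: subset_trans Bc.
Qed.

Lemma lebesgue_outer_box p (a b : 'rV[R]_p.+1) :
  (forall i, a 0%R i <= b 0%R i)%R ->
  lebesgue_outer (box a b) <= (box_volume a b)%:E.
Proof.
move=> ab; apply: ereal_inf_lbound.
exists (fun k => if k is 0%N then (a, b) else (a, a)).
  by split=> [[|k] i//|x abx]; exists 0%N.
rewrite nneseries_recl//; last first.
  by case=> [|k] _; rewrite lee_fin box_volume_ge0.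
rewrite (@eseries0 _ _ 1) ?adde0// => -[|k]// _ _.
by rewrite box_volume_degenerate.
Qed.

(** Dimension 0 is excluded: the empty product gives each box volume 1 there, so every cover would
    have infinite total volume. *)
Lemma lebesgue_outer0 p : lebesgue_outer (set0 : set 'rV[R]_p.+1) = 0.
Proof.
apply/eqP; rewrite eq_le lebesgue_outer_ge0 andbT.
have := @lebesgue_outer_box p 0%R 0%R (fun=> lexx _).
by rewrite box_volume_degenerate; apply: le_trans; exact: le_lebesgue_outer.
Qed.

(** When all the outer measures are finite, each [A n] has a cover whose excess is at most
    [e / 2 ^ n.+1]. A bijection between [nat] and [nat * nat] merges these covers into one sequence,
    and the excesses add up to at most [e]. *)
Lemma lebesgue_outer_sigma_subadditive m :
  sigma_subadditive (@lebesgue_outer R m).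
Proof.
move=> A; have [[i ioo]|Aoo] := pselect (exists i, lebesgue_outer (A i) = +oo).
  rewrite (eseries_pinfty _ _ ioo) ?leey// => n _.
  by rewrite -ltNye (lt_le_trans _ (lebesgue_outer_ge0 _ _)).
apply/lee_addgt0Pr => e e0.
rewrite (le_trans _ (epsilon_trick _ _ _))//; last 2 first.
- by move=> n; exact: lebesgue_outer_ge0.
- exact: ltW.
pose P n c := box_cover (A n) c /\
  \sum_(k <oo) (box_volume (c k).1 (c k).2)%:E <=
  lebesgue_outer (A n) + (e / (2 ^ n.+1)%:R)%:E.
have [G PG] : {G & forall n, P n (G n)}.
  apply: (@choice _ _ P) => n.
  have fin : lebesgue_outer (A n) \is a fin_num.
    rewrite ge0_fin_numE ?lebesgue_outer_ge0// ltey.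
    by apply/eqP => ?; apply: Aoo; exists n.
  have en : (0 < e / (2 ^ n.+1)%:R)%R by rewrite divr_gt0// ltr0n expn_gt0.
  have [_ [c cA <-] clt] := lb_ereal_inf_adherent en fin.
  by exists c; split => //; exact: ltW.
pose vol (ij : nat * nat) := (box_volume (G ij.1 ij.2).1 (G ij.1 ij.2).2)%:E.
have vol0 ij : 0 <= vol ij.
  by rewrite lee_fin box_volume_ge0//; exact: (PG ij.1).1.1.
have /card_esym/ppcard_eqP[f] := card_nat2.
apply: (@le_trans _ _ (\sum_(k <oo) vol (f k))).
  apply: ereal_inf_lbound; exists (fun k => G (f k).1 (f k).2) => //.
  split=> [k i|x [n _ /(PG n).1.2[k _ Gx]]]; first exact: (PG _).1.1.
  by exists (f^-1%FUN (n, k)) => //=; rewrite invK ?inE.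
rewrite nneseries_esumT// -(reindex_esum setT setT f vol) //.
rewrite (_ : setT = [set: nat] `*`` fun=> setT); last first.
  by apply/seteqP; split => // -[].
rewrite -(@esum_esum _ _ _ _ _ (fun i j => vol (i, j)))//.
rewrite -nneseries_esumT; last by move=> n; exact: esum_ge0.
apply: lee_nneseries => [n _ _|n _]; first exact: esum_ge0.
by rewrite -nneseries_esumT//; exact: (PG n).2.
Qed.

HB.instance Definition _ p := isOuterMeasure.Build R 'rV[R]_p.+1
  (@lebesgue_outer R p.+1) (lebesgue_outer0 p) (@lebesgue_outer_ge0 p.+1)
  (@le_lebesgue_outer p.+1) (@lebesgue_outer_sigma_subadditive p.+1).

Lemma outer_measure0_caratheodory T (mu : {outer_measure set T -> \bar R}) A :
  mu A = 0 -> mu.-caratheodory A.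
Proof.
move=> A0; apply: le_caratheodory_measurable => X.
rewrite (_ : mu (X `&` A) = 0) ?add0e ?le_outer_measure//.
by apply/eqP; rewrite eq_le outer_measure_ge0 andbT -A0 le_outer_measure.
Qed.

Lemma outer_measure_bigcup_seq T (mu : {outer_measure set T -> \bar R})
    (I : choiceType) (s : seq I) (F : I -> set T) :
  mu (\bigcup_(i in [set` s]) F i) <= \sum_(i <- s) mu (F i).
Proof.
rewrite bigcup_seq; elim: s => [|i s IHs].
  by rewrite !big_nil outer_measure0.
by rewrite !big_cons (le_trans (outer_measureU2 _ _ _))// leeD2l.
Qed.

End LebesgueOuter.

(** * Outer measure of a slab inside a cube *)

Lemma grid_cell {R : realDomainType} (n : nat) (h y : R) :
  0 <= y <= h * n.+1%:R -> exists k : 'I_n.+1, h * k%:R <= y <= h * k%:R + h.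
Proof.
elim: n => [|n IHn] /andP[y0 yh].
  by exists ord0; rewrite mulr0 add0r y0 -[h]mulr1.
have [yn|yn] := leP y (h * n.+1%:R).
  by have [|k hk] := IHn; [rewrite y0|exists (widen_ord (leqnSn _) k)].
by exists ord_max; rewrite (ltW yn)/= -[X in _ + X]mulr1 -mulrDr natr1.
Qed.

Section Slab.
Context {R : realType}.

(** Cut the range of the [p] coordinates other than [j] into [N.+1 ^ p] cells of side [h]. Over one
    cell, since [w 0 j = 1] and the other coefficients are at most 1 in absolute value, the slab
    confines coordinate [j] to an interval of half-length [t + p * h], hence of half-length [t + e].
    The boxes have total volume [(N.+1 * h) ^ p * (2 * (t + e))]. *)
Lemma lebesgue_outer_slab p (c w : 'rV[R]_p.+1) (j : 'I_p.+1) (r t e : R) :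
  w 0 j = 1 -> (forall i, `|w 0 i| <= 1) -> 0 <= r -> 0 <= t -> 0 < e ->
  (lebesgue_outer [set z : 'rV[R]_p.+1 |
     (forall i, `|z 0 i - c 0 i| <= r)%R /\
     (`|\sum_i w 0 i * (z 0 i - c 0 i)| <= t)%R] <=
   ((2 * r) ^+ p * (2 * (t + e)))%:E)%E.
Proof.
move=> wj w1 r0 t0 e0.
(* This makes the grid fine enough that [p * h <= e]. *)
pose N := Num.bound (p%:R * (2 * r) / e); pose h := 2 * r / N.+1%:R.
have h0 : 0 <= h by rewrite divr_ge0// mulr_ge0.
have hN : h * N.+1%:R = 2 * r by rewrite divfK// pnatr_eq0.
have phe : p%:R * h <= e.
  have : p%:R * (2 * r) / e < N%:R.
    by apply: archi_boundP; rewrite divr_ge0 ?mulr_ge0// ltW.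
  rewrite ltr_pdivrMr// => pN.
  by rewrite mulrA ler_pdivrMr ?ltr0Sn// -natr1; lra.
clearbody h.
pose u (k : {ffun 'I_p -> 'I_N.+1}) i := c 0 (lift j i) - r + h * (k i)%:R.
(* [b k] is the coordinate [j] of the point of the central hyperplane lying over the corner
   [u k]. *)
pose b k := c 0 j - \sum_i w 0 (lift j i) * (u k i - c 0 (lift j i)).
pose lo k := \row_l (if unlift j l is Some i then u k i else b k - (t + e)).
pose hi k := \row_l (if unlift j l is Some i then u k i + h else b k + (t + e)).
have lohi k l : lo k 0 l <= hi k 0 l.
  by rewrite !mxE; case: unliftP => [i|] _; lra.
have vol k : box_volume (lo k) (hi k) = h ^+ p * (2 * (t + e)).
  rewrite /box_volume (bigD1_ord j)//= mulrC; congr (_ * _); last first.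
    by rewrite !mxE unlift_none; ring.
  rewrite (eq_bigr (fun=> h)) ?prodr_const ?card_ord// => i _.
  by rewrite !mxE liftK; ring.
apply: (@le_trans _ _
    (lebesgue_outer (\bigcup_(k in [set` enum {ffun 'I_p -> 'I_N.+1}])
       box (lo k) (hi k)))).
  apply: le_lebesgue_outer => z [zr zt].
  have /choice[k hk] i : exists k : 'I_N.+1,
      h * k%:R <= z 0 (lift j i) - c 0 (lift j i) + r <= h * k%:R + h.
    by apply: grid_cell; move: (zr (lift j i)); rewrite hN ler_norml; lra.
  exists [ffun i => k i]; first by rewrite /= mem_enum.
  have uz i : 0 <= z 0 (lift j i) - u [ffun i => k i] i <= h.
    by move: (hk i); rewrite /u ffunE; lra.
  move=> l; rewrite !mxE; case: unliftP => [i ->|->].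
    by have := uz i; lra.
  suff : `|z 0 j - b [ffun i => k i]| <= t + e by rewrite ler_norml; lra.
  (* The first sum is bounded by [t] because [z] lies in the slab, the second by [p * h] because [z]
     lies over the cell. *)
  rewrite (_ : _ - _ = \sum_i w 0 i * (z 0 i - c 0 i) -
      \sum_i w 0 (lift j i) * (z 0 (lift j i) - u [ffun i => k i] i)); last first.
    rewrite (bigD1_ord j)//= wj mul1r -addrA -sumrB /b opprB addrCA addrC.
    congr (_ + _); apply: eq_bigr => i _; ring.
  rewrite (le_trans (ler_normB _ _))// lerD// (le_trans _ phe)//.
  rewrite (le_trans (ler_norm_sum _ _ _))//.
  rewrite (le_trans (ler_sum (G := fun=> h) _ _))//.
    move=> i _; have /andP[z0 zh] := uz i.
    by rewrite normrM (ger0_norm z0) (le_trans _ zh)// ler_piMl.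
  by rewrite sumr_const card_ord mulr_natl.
apply: le_trans.
  exact: (@outer_measure_bigcup_seq R _ (@lebesgue_outer R p.+1)).
apply: (@le_trans _ _ (\sum_(k <- enum {ffun 'I_p -> 'I_N.+1})
   (h ^+ p * (2 * (t + e)))%:E)%E).
  by apply: lee_sum => k _; rewrite -(vol k) lebesgue_outer_box.
rewrite sumEFin lee_fin big_const_seq count_predT -cardE card_ffun !card_ord.
rewrite iter_addr addr0 -[_ *+ (_ ^ _)]mulr_natl natrX.
rewrite -hN exprMn; lra.
Qed.

End Slab.

Definition cube {R : realType} {m : nat} (a : 'rV[R]_m) (s : R) : set 'rV[R]_m :=
  box a (a + const_mx s).

Lemma cubeP {R : realType} {m : nat} (a : 'rV[R]_m) (s : R) x :
  cube a s x <-> forall i, a 0 i <= x 0 i <= a 0 i + s.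
Proof. by split=> h i; have := h i; rewrite !mxE. Qed.

(** * Dyadic stopping time *)

Section StoppingTime.
Context {R : realType} {T : Type} (mu : {outer_measure set T -> \bar R}) {m : nat}.
Context (f : 'rV[R]_m -> T) (S : set 'rV[R]_m) (c : R).

Local Definition good a s := (mu (f @` (cube a s `&` S)) <= (c * s ^+ m)%:E)%E.

Local Definition halves (a : 'rV[R]_m) (s : R) : seq 'rV[R]_m :=
  [seq a + (s / 2) *: \row_i (d i)%:R | d : {ffun 'I_m -> bool}].

Local Lemma halves_cover a s x : cube a s x ->
  exists2 b, b \in halves a s & cube b (s / 2) x.
Proof.
move=> /cubeP ax; pose d := [ffun i => a 0 i + s / 2 <= x 0 i].
exists (a + (s / 2) *: \row_i (d i)%:R).
  by apply/mapP; exists d => //; rewrite mem_enum.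
apply/cubeP => i; have := ax i; rewrite !mxE /d ffunE.
by case: (leP (a 0 i + s / 2) (x 0 i)) => /= h; lra.
Qed.

Context (a : 'rV[R]_m) (s : R).

Local Definition side n : R := s / 2 ^+ n.

Local Lemma sideS n : side n.+1 = side n / 2.
Proof. by rewrite /side exprSr invfM mulrA. Qed.

(* Lower corners of the level-n dyadic subcubes none of whose proper ancestors is
   good. *)
Fixpoint dyadic_pending n : seq 'rV[R]_m :=
  if n is n'.+1 then
    flatten [seq halves b (side n') |
             b <- dyadic_pending n' & ~~ `[< good b (side n') >]]
  else [:: a].

(** These are the maximal good dyadic subcubes, sorted by level. *)
Definition dyadic_selected n : seq 'rV[R]_m :=
  [seq b <- dyadic_pending n | `[< good b (side n) >]].

Lemma size_dyadic_pendingS n :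
  (size (dyadic_pending n.+1) =
   2 ^ m * (size (dyadic_pending n) - size (dyadic_selected n)))%N.
Proof.
rewrite /dyadic_selected/= size_flatten /shape -map_comp.
rewrite (eq_map (g := fun=> (2 ^ m)%N)); last first.
  by move=> b /=; rewrite size_map -cardE card_ffun card_bool card_ord.
rewrite sumnE big_map big_const_seq count_predT iter_addn addn0 !size_filter.
congr (_ * _)%N; set P := fun b => `[< good b (side n) >].
by rewrite -(count_predC P (dyadic_pending n)) addKn.
Qed.

(** Conservation of volume: a cube is either selected or replaced by [2 ^ m] halves of the same
    total volume, so the volume selected before level [N] and the volume pending at level [N] add up
    to [s ^ m]. *)
Lemma sum_dyadic_selected N :
  \sum_(0 <= n < N) (size (dyadic_selected n))%:R * side n ^+ m =
  s ^+ m - (size (dyadic_pending N))%:R * side N ^+ m.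
Proof.
elim: N => [|N IHN].
  by rewrite big_geq// /side expr0 divr1 mul1r subrr.
rewrite big_nat_recr//= IHN size_dyadic_pendingS sideS natrM natrB; last first.
  by rewrite size_filter count_size.
rewrite natrX mulrAC -exprMn [2 * _]mulrC divfK ?pnatr_eq0//; ring.
Qed.

Lemma dyadic_selected_cover x N : cube a s x ->
  (exists n, exists2 b, b \in dyadic_selected n & cube b (side n) x) \/
  (exists2 b, b \in dyadic_pending N & cube b (side N) x).
Proof.
move=> ax; elim: N => [|N [|[b bN bx]]]; [|by left|].
  by right; exists a; rewrite ?inE// /side expr0 divr1.
have [bg|bg] := pselect (good b (side N)).
  left; exists N, b => //; rewrite mem_filter bN andbT; exact/asboolP.
have [d db dx] := halves_cover _ _ _ bx.
right; exists d; last by rewrite sideS.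
apply/flattenP; exists (halves b (side N)) => //.
by apply/map_f; rewrite mem_filter bN andbT; exact/asboolPn.
Qed.

(** The selected cubes cover the part of [S] in the cube, since around each point of [S] all small
    cubes are good. Countable subadditivity then bounds the image by [c] times the selected volume,
    which is at most [s ^ m]. *)
Lemma outer_measure_image_cube : 0 <= c -> 0 < s ->
  (forall x, S x -> exists2 d, 0 < d & forall b t, 0 < t < d -> cube b t x ->
     good b t) ->
  good a s.
Proof.
move=> c0 s0 Sgood; rewrite /good.
pose F n := \bigcup_(b in [set` dyadic_selected n]) (f @` (cube b (side n) `&` S)).
have side0 n : 0 < side n by rewrite divr_gt0// exprn_gt0.
apply: (@le_trans _ _ (mu (\bigcup_n F n))).
  apply: le_outer_measure => _ [x [ax Sx] <-].
  have [d d0 dgood] := Sgood x Sx.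
  (* Here [s / d < N < 2 ^ N], so cubes of level [N] have side less than [d]. *)
  pose N := Num.bound (s / d).
  have sideN : side N < d.
    rewrite ltr_pdivrMr ?exprn_gt0// mulrC -ltr_pdivrMr//.
    have /lt_trans : s / d < N%:R.
      by apply: archi_boundP; rewrite divr_ge0// ltW.
    by apply; rewrite -natrX ltr_nat ltn_expl.
  have [[n [b bn bx]]|[b bN bx]] := dyadic_selected_cover x N ax.
    by exists n => //; exists b => //; exists x.
  (* If no earlier cube around [x] was selected, the pending one at level [N] is small enough to be
     good. *)
  exists N => //; exists b; last by exists x.
  rewrite /= mem_filter bN andbT; apply/asboolP.
  by apply: dgood bx; rewrite side0.
rewrite (le_trans (outer_measure_sigma_subadditive mu F))//.
apply: (@le_trans _ _
  (\sum_(n <oo) (c * ((size (dyadic_selected n))%:R * side n ^+ m))%:E)%E).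
  apply: lee_nneseries => [n _ _|n _]; first exact: outer_measure_ge0.
  rewrite (le_trans (outer_measure_bigcup_seq _ _ _ _ _))//.
  apply: (@le_trans _ _
    (\sum_(b <- dyadic_selected n) (c * side n ^+ m)%:E)%E).
    rewrite !big_seq; apply: lee_sum => b.
    by rewrite mem_filter => /andP[/asboolP].
  rewrite sumEFin lee_fin big_const_seq count_predT iter_addr addr0.
  by rewrite -[_ *+ size _]mulr_natl mulrCA.
apply: lime_le.
  apply: is_cvg_nneseries => n _ _.
  by rewrite lee_fin !mulr_ge0// exprn_ge0// ltW.
apply: nearW => N; rewrite sumEFin lee_fin -mulr_sumr ler_wpM2l//.
by rewrite sum_dyadic_selected gerBl mulr_ge0// exprn_ge0// ltW.
Qed.

End StoppingTime.

(** * Norm estimates, differentials and singular matrices *)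

Lemma ler_coord_norm {R : realType} m n (x : 'M[R]_(m, n)) i j :
  `|x i j| <= `|x|.
Proof.
by rewrite [leRHS]/Num.norm/= mx_normrE (le_bigmax _ (fun ij => `|x ij.1 ij.2|) (i, j)).
Qed.

Lemma cube_dist_le {R : realType} m (a x y : 'rV[R]_m) s : 0 <= s ->
  cube a s x -> cube a s y -> `|x - y| <= s.
Proof.
move=> s0 /cubeP ax /cubeP ay; rewrite [leLHS]/Num.norm/= mx_normrE.
apply: bigmax_le => // -[k i] _; rewrite ord1 !mxE.
by have := ax i; have := ay i; rewrite ler_norml; lra.
Qed.

Lemma linear_rV_continuous {R : realType} m n
  (A : {linear 'rV[R]_m.+1 -> 'rV[R]_n.+1}) : continuous A.
Proof.
apply/bounded_linear_continuous/bounded_funP => r.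
exists (r * \sum_j `|A (delta_mx 0 j)|) => x xr.
rewrite [x]row_sum_delta linear_sum mulr_sumr.
rewrite (le_trans (ler_norm_sum _ _ _))// ler_sum// => j _.
rewrite linearZ normrZ ler_wpM2r// (le_trans _ xr)//.
exact: ler_coord_norm.
Qed.

(** Fixing the second point of the pair at [u] leaves ordinary differentiability with derivative
    [A]; uniqueness of the differential identifies [A] with ['d F u]. *)
Lemma strongly_differentiable_local {R : realType} m n
    (U : set 'rV[R]_m.+1) (F : 'rV[R]_m.+1 -> 'rV[R]_n.+1) u :
  strongly_differentiable U F u -> forall e : R, 0 < e ->
  exists2 d : R, 0 < d & forall y, U y -> `|y - u| < d ->
    `|F y - F u - 'd F u (y - u)| <= e * `|y - u|.
Proof.
move=> [Uu [A FA]].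
have near_u (e : R) : 0 < e -> exists2 d : R, 0 < d & forall y, U y -> `|y - u| < d ->
    `|F y - F u - A (y - u)| <= e * `|y - u|.
  move=> e0; have := cvgr0_norm_le _ FA _ e0.
  move=> /(_ (within_filter _ (nbhs_filter _))).
  rewrite near_withinE => /nbhs_ballP[d /= d0 dF]; exists d => // y Uy yud.
  (* The limit ranges over distinct points only, so [y = u] is checked directly. *)
  have [->|yu] := eqVneq y u; first by rewrite !subrr linear0 subr0 !normr0 mulr0.
  have /(_ _)/= := dF (y, u).
  have yu0 : 0 < `|y - u| by rewrite normr_gt0 subr_eq0.
  rewrite normrZ normfV normr_id -ler_pdivlMl ?invr_gt0// invrK mulrC; apply.
    by split => /=; [rewrite -ball_normE/= distrC|exact: ballxx].
  by split => //; exact: interior_subset.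
suff -> : 'd F u = A :> (_ -> _) by [].
apply: diff_unique; first exact: linear_rV_continuous.
apply/eqaddoP => e e0; have [d d0 Fd] := near_u e e0.
(* The little-o condition concerns a full neighbourhood, so the radius is also shrunk to stay inside
   [U]. *)
have /nbhs_ballP[d' /= d'0 d'U] := Uu.
apply/nbhs_ballP; exists (Num.min d d') => /=; first by rewrite lt_min d0.
move=> h; rewrite -ball_normE/= sub0r normrN lt_min => /andP[hd hd'].
have /(_ (h + u)) := Fd; rewrite addrK !fctE/= opprD addrA; apply => //.
by apply: d'U; rewrite -ball_normE/= opprD addrCA subrr addr0 normrN.
Qed.

(** A nonzero vector in the kernel of the transpose annihilates the range of [M]; dividing it by an
    entry of largest absolute value gives the normalization used for slabs. *)
Lemma notin_unitmx_covector {R : realType} m (M : 'M[R]_m) : M \notin unitmx ->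
  exists j, exists w : 'rV[R]_m, [/\ w 0 j = 1, forall i, `|w 0 i| <= 1 &
    forall v : 'rV[R]_m, \sum_i w 0 i * (v *m M) 0 i = 0].
Proof.
rewrite -unitmx_tr unitmxE unitfE negbK => /eqP/eqP/det0P[v v0 vM].
have [[k j]] : exists ij, mx_norm v = `|v ij.1 ij.2|.
  by apply: mx_norm_neq0; apply: contra_neq v0; exact: mx_norm_eq0.
rewrite ord1 /= => vj; have vj0 : v 0 j != 0.
  by rewrite -normr_eq0 -vj; apply: contra_neq v0; exact: mx_norm_eq0.
exists j, ((v 0 j)^-1 *: v); split.
- by rewrite mxE mulVf.
- move=> i; rewrite mxE normrM normfV ler_pdivrMl ?normr_gt0// mulr1 -vj.
  exact: ler_coord_norm.
- move=> z; transitivity (((v 0 j)^-1 *: v *m (z *m M)^T) 0 0).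
    by rewrite !mxE; apply: eq_bigr => i _; rewrite !mxE.
  by rewrite trmx_mul mulmxA -scalemxAl vM scaler0 mul0mx mxE.
Qed.

(** The Lipschitz bound holds for every constant above some [M], so a positive one can be chosen. *)
Lemma lipschitz_gt0 {R : realType} {V W : normedModType R} (f : V -> W) A :
  [lipschitz f x | x in A] -> exists2 L : R, 0 < L &
    forall x y, A x -> A y -> `|f x - f y| <= L * `|x - y|.
Proof.
move=> [M [_ fM]]; exists (Num.max M 0 + 1).
  by rewrite ltr_pwDr// le_max lexx orbT.
move=> x y Ax Ay; apply: (fM _ _ (x, y)) => //.
by rewrite ltr_pwDr// le_max lexx.
Qed.

(** * Images of the singular points *)

(** The image lies within [L * t] of [G x]. The covector kills ['d G x (y - x)], so only the
    remainder contributes to its value on [G y - G x], at most [p.+1 * (e * t)]. The slab bound with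
    slack [e * t] turns [p.+1] into [p.+2]. *)
Lemma lebesgue_outer_image_singular_cube {R : realType} p
    (G : 'rV[R]_p.+1 -> 'rV[R]_p.+1) (S : set 'rV[R]_p.+1) x (L e d : R) :
  'J G x \notin unitmx -> 0 < L -> 0 < e ->
  (forall y, S y -> `|G y - G x| <= L * `|y - x|) ->
  (forall y, S y -> `|y - x| < d ->
     `|G y - G x - 'd G x (y - x)| <= e * `|y - x|) ->
  forall b t, 0 < t < d -> cube b t x ->
  (lebesgue_outer (G @` (cube b t `&` S)) <=
   ((2 * L) ^+ p * (2 * p.+2%:R) * e * t ^+ p.+1)%:E)%E.
Proof.
move=> Jx L0 e0 GL Ge b t /andP[t0 td] bx.
have [j [w [wj w1 wJ]]] := notin_unitmx_covector _ _ Jx.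
have Lt0 : 0 <= L * t by rewrite mulr_ge0// ltW.
have et0 : 0 < e * t by rewrite mulr_gt0.
have pet0 : 0 <= p.+1%:R * (e * t) by rewrite mulr_ge0// ltW.
have := lebesgue_outer_slab _ (G x) w j _ _ _ wj w1 Lt0 pet0 et0.
rewrite (_ : (2 * (L * t)) ^+ p * _ =
    (2 * L) ^+ p * (2 * p.+2%:R) * e * t ^+ p.+1); last first.
  by rewrite !exprMn exprS -[p.+2%:R]natr1; ring.
apply: le_trans; apply: le_lebesgue_outer => _ [y [Qy Sy] <-].
have yx : `|y - x| <= t by apply: cube_dist_le bx; rewrite // ltW.
split=> [i|].
  have := ler_coord_norm _ _ (G y - G x) 0 i; rewrite !mxE => /le_trans; apply.
  by rewrite (le_trans (GL y Sy))// ler_wpM2l// ltW.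
have Ey := Ge y Sy (le_lt_trans yx td).
rewrite (_ : \sum_i _ = \sum_i w 0 i * (G y - G x - 'd G x (y - x)) 0 i).
  rewrite (le_trans (ler_norm_sum _ _ _))//.
  rewrite (le_trans (ler_sum (G := fun=> e * t) _ _))//.
    move=> i _; rewrite normrM -[leRHS]mul1r ler_pM//.
    rewrite (le_trans (ler_coord_norm _ _ _ _ _))// (le_trans Ey)//.
    by rewrite ler_wpM2l// ltW.
  by rewrite sumr_const card_ord mulr_natl.
have := wJ (y - x); rewrite mul_rV_lin1 => wJ0.
transitivity (\sum_i w 0 i * (G y - G x) 0 i -
    \sum_i w 0 i * 'd G x (y - x) 0 i).
  by rewrite wJ0 subr0; apply: eq_bigr => i _; rewrite !mxE.
rewrite -sumrB; apply: eq_bigr => i _.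
by rewrite [in RHS]mxE [X in _ * (_ + X)]mxE mulrBr.
Qed.

Lemma lebesgue_outer_image_singular {R : realType} p
    (Omega : set 'rV[R]_p.+1) (G : 'rV[R]_p.+1 -> 'rV[R]_p.+1)
    (S : set 'rV[R]_p.+1) :
  S `<=` Omega -> [lipschitz G x | x in Omega] ->
  (forall x, S x -> strongly_differentiable Omega G x) ->
  (forall x, S x -> 'J G x \notin unitmx) ->
  lebesgue_outer (G @` S) = 0%E.
Proof.
move=> SO /lipschitz_gt0[L L0 GL] GS JS.
pose C := (2 * L) ^+ p * (2 * p.+2%:R).
have C0 : 0 < C by rewrite mulr_gt0 ?exprn_gt0 ?mulr_gt0.
have cube0 (a : 'rV[R]_p.+1) (s : R) : 0 < s ->
    lebesgue_outer (G @` (cube a s `&` S)) = 0%E.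
  move=> s0; apply/eqP; rewrite eq_le lebesgue_outer_ge0 andbT.
  apply/lee_addgt0Pr => eps eps0; rewrite add0e.
  (* With this [e], the stopping-time bound [C * e * s ^+ p.+1] is exactly [eps]. *)
  pose e := eps / (C * s ^+ p.+1).
  have Cs0 : 0 < C * s ^+ p.+1 by rewrite mulr_gt0// exprn_gt0.
  have e0 : 0 < e by rewrite divr_gt0.
  rewrite (_ : eps = C * e * s ^+ p.+1); last first.
    by rewrite mulrAC mulrC divfK// gt_eqF.
  apply: (@outer_measure_image_cube R _ (@lebesgue_outer R p.+1)) => //.
    by rewrite mulr_ge0// ltW.
  move=> x Sx.
  have [d d0 Gd] := strongly_differentiable_local _ _ _ _ _ (GS x Sx) e e0.
  exists d => // b t; apply: lebesgue_outer_image_singular_cube => //.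
  - exact: JS.
  - by move=> y Sy; apply: GL; exact: SO.
  - by move=> y Sy; apply: Gd; exact: SO.
(* The cubes with all coordinates between [- n.+1] and [n.+1] exhaust the space, so countably many
   null images suffice. *)
pose Q n := cube (const_mx (- n.+1%:R) : 'rV[R]_p.+1) (2 * n.+1%:R).
apply/eqP; rewrite eq_le lebesgue_outer_ge0 andbT.
have -> : G @` S = \bigcup_n (G @` (Q n `&` S)).
  apply/seteqP; split=> [_ [x Sx <-]|_ [n _ [x [_ Sx] <-]]]; last by exists x.
  exists (Num.bound `|x|) => //; exists x => //; split=> //; apply/cubeP => i.
  have := archi_boundP (normr_ge0 x); have := ler_coord_norm _ _ x 0 i.
  by rewrite mxE -natr1 ler_norml; lra.
rewrite (le_trans (lebesgue_outer_sigma_subadditive _ _))//.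
by rewrite eseries0// => n _ _; apply: cube0; rewrite mulr_gt0.
Qed.

Theorem theorem11 (R : realType) (m : nat) (hm : (1 <= m)%N)
    (Omega K : set 'rV[R]_m) (G : 'rV[R]_m -> 'rV[R]_m)
    (hOmega : open Omega)
    (hKOmega : K `<=` Omega)
    (hK : has_lebesgue_measure0 K)
    (hLip : [lipschitz G x | x in Omega])
    (hG : forall x, (Omega `\` K) x -> strongly_differentiable Omega G x) :
  has_lebesgue_measure0
    (G @` [set x | (Omega `\` K) x /\ 'J G x \notin unitmx]).
Proof.
case: m hm Omega K G hOmega hKOmega hK hLip hG => // p _ Omega K G _ _ _ hLip hG.
have outer0 : lebesgue_outer
    (G @` [set x | (Omega `\` K) x /\ 'J G x \notin unitmx]) = 0%E.
  apply: (lebesgue_outer_image_singular _ Omega) => // x [] //.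
    by move=> [].
  by move=> /hG.
split=> //; exact: (outer_measure0_caratheodory _ (@lebesgue_outer R p.+1)).
Qed.
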